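(* Let $D\ge 1$, and let $(\psi_h)_{h}$ and $(\pi_h)_{h}$ be families of invertible maps $\mathbb{R}^D\to\mathbb{R}^D$ indexed by a real step size $h$ (ranging over a set symmetric about $0$). Let $\pi_h^\star$ denote the adjoint of $\pi_h$, and for an integer $N\ge 1$ let $$\widetilde{\psi}_{N,h} = \pi_h^\star \circ \psi_h^N \circ \pi_h$$ be the map that performs an integration leg of $N$ steps with the symmetric (modified) processed integrator with kernel $\psi_h$ and preprocessor $\pi_h$. If the kernel $\psi_h$ is time reversible, then the symmetric processed integrator is time reversible, i.e. $$(\widetilde{\psi}_{N,h})^{-1} = \widetilde{\psi}_{N,-h}.$$
   Context: A one-step integrator is specified by a map $\psi_h:\mathbb{R}^D\to\mathbb{R}^D$ depending on a real step size $h$ that advances the numerical solution over a time interval of length $h$; $\psi_h^N$ denotes the $N$-fold composition $\psi_h\circ\cdots\circ\psi_h$. The integrator $\psi_h$ is called time reversible (or symmetric) if $(\psi_h^N)^{-1}=\psi_{-h}^N$. The adjoint $\pi_h^\star$ of a family of maps $\pi_h$ is the family determined by $\pi_{-h}^\star = \pi_h^{-1}$ for all $h$, i.e. $\pi_h^\star = (\pi_{-h})^{-1}$. The symmetric processed integrator is called time reversible if $(\widetilde{\psi}_{N,h})^{-1} = \widetilde{\psi}_{N,-h}$. *)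

(* Defs.v *)
From mathcomp Require Import all_boot all_order all_algebra.
From mathcomp Require Import all_classical all_reals.
Set Implicit Arguments.
Unset Strict Implicit.
Unset Printing Implicit Defensive.
Import Order.TTheory GRing.Theory Num.Theory.
Local Open Scope classical_set_scope.
Local Open Scope ring_scope.

(* The inverse of a map of T onto itself. The default value [id], used outside
   the range of [f], plays no role when [f] is bijective: see [invmapP]. *)
Definition invmap (T : Type) (f : T -> T) : T -> T := 'pinv_id [set: T] f.

Lemma invmapP (T : Type) (f : T -> T) :
  bijective f -> cancel f (invmap f) /\ cancel (invmap f) f.
Proof.
move=> bf; split=> x.
  by apply: pinvKV; rewrite ?in_setT //; move=> y z _ _; exact: bij_inj.
apply: pinvK; rewrite inE; have [g _ gK] := bf.
by exists (g x).
Qed.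

(* A family of maps of R^D indexed by a step size. It is given as a total
   function of h : R, but only its values at the admissible step sizes (the
   elements of the set H below) are ever meaningful. *)
Definition step_family (R : realType) (D : nat) : Type :=
  R -> 'rV[R]_D -> 'rV[R]_D.

Definition invertible_on (R : realType) (D : nat) (H : set R)
    (phi : step_family R D) : Prop :=
  forall h : R, H h -> bijective (phi h).

Definition time_reversible (R : realType) (D : nat) (H : set R)
    (psi : step_family R D) : Prop :=
  forall N : nat, (0 < N)%N -> forall h : R, H h ->
    invmap (iter N (psi h)) = iter N (psi (- h)).

Definition adjoint (R : realType) (D : nat) (pi : step_family R D) : step_family R D :=
  fun h => invmap (pi (- h)).

Definition sym_processed (R : realType) (D : nat) (psi pi : step_family R D)
    (N : nat) : step_family R D :=
  fun h => adjoint pi h \o iter N (psi h) \o pi h.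

(* Main.v *)
Require Import Defs.
From mathcomp Require Import all_boot all_order all_algebra.
From mathcomp Require Import all_classical all_reals.
Set Implicit Arguments.
Unset Strict Implicit.
Unset Printing Implicit Defensive.
Import Order.TTheory GRing.Theory Num.Theory.
Local Open Scope classical_set_scope.
Local Open Scope ring_scope.

(** Inverting the composite reverses it: pi_h^-1 o (psi_h^N)^-1 o pi_{-h}. Reversibility of the
    kernel makes the middle factor psi_{-h}^N, and pi_h^-1 is the adjoint of [pi] at -h, so this is
    the processed leg at -h. [invmap_uniq] reduces the equality to two cancellations. *)

Lemma invmap_uniq (T : Type) (f g : T -> T) :
  cancel f g -> cancel g f -> invmap f = g.
Proof.
move=> fK gK; have [iK _] := invmapP (Bijective fK gK).
by apply: funext => x; rewrite -{1}(gK x) iK.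
Qed.

Lemma bijective_iter (T : Type) (f : T -> T) (n : nat) :
  bijective f -> bijective (iter n f).
Proof.
move=> bf; elim: n => [|n IHn]; first by exists id.
exact: (bij_comp bf IHn).
Qed.

Theorem mainTheorem1 (R : realType) (D : nat) (hD : (0 < D)%N)
    (H : set R) (Hsym : forall h : R, H h -> H (- h))
    (psi pi : step_family R D)
    (psi_inv : invertible_on H psi) (pi_inv : invertible_on H pi)
    (psi_rev : time_reversible H psi) :
  forall N : nat, (0 < N)%N -> forall h : R, H h ->
    invmap (sym_processed psi pi N h) = sym_processed psi pi N (- h).
Proof.
move=> N N_gt0 h Hh.
have [piK piVK] := invmapP (pi_inv _ Hh).
have [piNK piNVK] := invmapP (pi_inv _ (Hsym _ Hh)).
have [psiK psiVK] := invmapP (bijective_iter N (psi_inv _ Hh)).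
(* Now [iter N (psi h)] and [iter N (psi (- h))] cancel each other. *)
rewrite (psi_rev _ N_gt0 _ Hh) in psiK psiVK.
(* [opprK] turns the adjoint at [- h] into [invmap (pi h)], so each composite telescopes from the
   inside. *)
apply: invmap_uniq => x; rewrite /sym_processed /adjoint /= opprK.
  by rewrite piNVK psiK piK.
by rewrite piVK psiVK piNK.
Qed.
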